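(* Let $\eta>0$ and let $v,v'\in S^{d-1}$ with $v\ne v'$ and $\langle v,v'\rangle>1/\sqrt{2+\eta}$. Let $V=\mathrm{span}\{v,v'\}$ and let $u_1^{(1)},u_2^{(1)}\in S^{d-1}$ be such that $(u_1^{(1)})_V\ne 0$ and $(u_2^{(1)})_V\ne 0$. Let $u_i^{(t+1)}=f(u_i^{(t)},v^{(t)})$ for $i=1,2$ and $t\ge 1$, where the interventions $v^{(1)},v^{(2)},\ldots$ are independent, each equal to $v$ or $v'$ with probability $1/2$ (the same $v^{(t)}$ being applied to both opinions). Then, almost surely, either $\|u_1^{(t)}-u_2^{(t)}\|$ converges to $0$ or $\|u_1^{(t)}+u_2^{(t)}\|$ converges to $0$ as $t\to\infty$.
   Context: $S^{d-1}$ is the Euclidean unit sphere in $\mathbb{R}^d$, $\langle\cdot,\cdot\rangle$ the standard inner product. For a fixed parameter $\eta>0$, applying an intervention $\bar v\in S^{d-1}$ to an opinion $u\in S^{d-1}$ gives $f(u,\bar v)=w/\|w\|$, where $w=u+\eta\langle u,\bar v\rangle\bar v$ (here $\|w\|\ge1$). For a subspace $V$, $u_V$ denotes the orthogonal projection of $u$ onto $V$. *)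

(* Defs.v *)
From HB Require Import structures.
From mathcomp Require Import all_boot all_order all_algebra finmap.
From mathcomp Require Import all_classical all_reals all_analysis.

Set Implicit Arguments.
Unset Strict Implicit.
Unset Printing Implicit Defensive.

Import Order.TTheory GRing.Theory Num.Theory.
Import numFieldNormedType.Exports.
Local Open Scope classical_set_scope.
Local Open Scope ring_scope.

(* The Euclidean norm is needed explicitly: the library norm `|u| on row
   vectors is the maximum norm. *)
Definition dot {R : realType} {d : nat} (u v : 'rV[R]_d) : R :=
  \sum_(i < d) u 0 i * v 0 i.

Definition enorm {R : realType} {d : nat} (u : 'rV[R]_d) : R :=
  Num.sqrt (dot u u).

Definition sphere {R : realType} {d : nat} : set 'rV[R]_d :=
  [set u | enorm u = 1].

(* A subspace is given as the row space of a matrix U; the rows w of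
   kermx U^T are exactly those with w *m U^T = 0, so that kermx U^T spans the
   orthogonal complement (see orth_projP). *)
Definition orth_proj {R : realType} {m d : nat} (U : 'M[R]_(m, d))
    (u : 'rV[R]_d) : 'rV[R]_d :=
  u *m proj_mx <<U>>%MS (kermx U^T).

Lemma dotE {R : realType} {d : nat} (u v : 'rV[R]_d) :
  dot u v = (u *m v^T) 0 0.
Proof. by rewrite mxE; apply: eq_bigr => i _; rewrite mxE. Qed.

Lemma dot_eq0 {R : realType} {d : nat} (u : 'rV[R]_d) : dot u u = 0 -> u = 0.
Proof.
move=> /eqP; rewrite psumr_eq0 => [|i _]; last by rewrite -expr2 sqr_ge0.
move=> /allP u0; apply/rowP => i; rewrite mxE.
by have := u0 i (mem_index_enum _); rewrite mulf_eq0 orbb => /eqP.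
Qed.

Lemma orth_projP {R : realType} {m d : nat} (U : 'M[R]_(m, d))
    (u : 'rV[R]_d) :
  (orth_proj U u <= U)%MS /\
  forall w : 'rV[R]_d, (w <= U)%MS -> dot (u - orth_proj U u) w = 0.
Proof.
have sub_ker (w x : 'rV[R]_d) : (w <= U)%MS -> (x <= kermx U^T)%MS ->
    dot x w = 0.
  move=> /submxP[a ->] /sub_kermxP xU.
  by rewrite dotE trmx_mul mulmxA xU mul0mx mxE.
have dxU : (<<U>> :&: kermx U^T = 0)%MS.
  apply/eqP/rowV0P => x; rewrite sub_capmx genmxE => /andP[xU xK].
  exact/dot_eq0/sub_ker.
have full : (u <= <<U>> + kermx U^T)%MS.
  apply: submx_full; rewrite /row_full mxrank_disjoint_sum //.
  by rewrite genmxE mxrank_ker mxrank_tr subnKC // rank_leq_col.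
split=> [|w wU].
  by apply: submx_trans (proj_mx_sub _ _ _) _; rewrite genmxE.
by apply: sub_ker => //; exact: proj_mx_compl_sub.
Qed.

Definition intervene {R : realType} {d : nat} (eta : R) (u v : 'rV[R]_d) :
    'rV[R]_d :=
  let w := u + (eta * dot u v) *: v in (enorm w)^-1 *: w.

(* Time starts at 0: opinion eta u vs t is the opinion held after the
   interventions vs 0, ..., vs t.-1 have been applied in turn. *)
Fixpoint opinion {R : realType} {d : nat} (eta : R) (u : 'rV[R]_d)
    (vs : nat -> 'rV[R]_d) (t : nat) : 'rV[R]_d :=
  if t is s.+1 then intervene eta (opinion eta u vs s) (vs s) else u.

(* R^d with its Borel sigma-algebra. *)
Definition borel_rV (R : realType) (d : nat) :=
  g_sigma_algebraType (@open 'rV[R]_d).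

Definition mutually_independent (dT dE : measure_display)
    (T : measurableType dT) (E : measurableType dE) (R : realType)
    (P : probability T R) (I : choiceType) (X : I -> {RV P >-> E}) : Prop :=
  forall (J : {fset I}) (B : I -> set E),
    (forall i, i \in J -> measurable (B i)) ->
    P (\bigcap_(i in [set` J]) (X i @^-1` B i)) =
    (\prod_(i <- J) P (X i @^-1` B i))%E.

(* Main.v *)
Require Import Defs.
From HB Require Import structures.
From mathcomp Require Import all_boot all_order all_algebra finmap.
From mathcomp Require Import all_classical all_reals all_analysis.
From mathcomp Require Import ring lra.

Import Order.TTheory GRing.Theory Num.Theory.
Import numFieldNormedType.Exports.
Local Open Scope classical_set_scope.
Local Open Scope ring_scope.

(* Up to normalisation, an intervention is the linear map
   [x |-> x + eta <x, v> v], which expands areas by at most [1 + eta].  For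
   [1 / sqrt (2 + eta) < c < <v, v'>], the convex cone of all [x] with
   [<x, v>, <x, v'> >= c |x|] is invariant under both maps, and in it each map
   multiplies [|x| ^ 2] by at least [1 + (2 eta + eta ^ 2) c ^ 2 > 1 + eta].
   Hence, once the V-parts of both opinions lie in the cone or its opposite,
   the squared sine of the angle between the unnormalised opinions decays
   geometrically, while the sign of their inner product is eventually constant
   because it changes monotonically.  From any nonzero vector of V, a suitable
   choice of v or v', repeated a fixed number n of times, leads into the cone
   or its opposite.  Whatever the past, these n choices have probability 2^-n,
   so that almost surely they are made at some time. *)

(** * Inner product and Euclidean norm *)

Lemma dotC {R : realType} {d : nat} (x y : 'rV[R]_d) : dot x y = dot y x.
Proof. by apply: eq_bigr => i _; rewrite mulrC. Qed.

Lemma dotDl {R : realType} {d : nat} (x y z : 'rV[R]_d) :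
  dot (x + y) z = dot x z + dot y z.
Proof. by rewrite -big_split; apply: eq_bigr => i _; rewrite mxE mulrDl. Qed.

Lemma dotZl {R : realType} {d : nat} a (x y : 'rV[R]_d) :
  dot (a *: x) y = a * dot x y.
Proof. by rewrite mulr_sumr; apply: eq_bigr => i _; rewrite mxE mulrA. Qed.

Lemma dotNl {R : realType} {d : nat} (x y : 'rV[R]_d) : dot (- x) y = - dot x y.
Proof. by rewrite -scaleN1r dotZl mulN1r. Qed.

Lemma dotDr {R : realType} {d : nat} (x y z : 'rV[R]_d) :
  dot x (y + z) = dot x y + dot x z.
Proof. by rewrite dotC dotDl !(dotC _ x). Qed.

Lemma dotZr {R : realType} {d : nat} a (x y : 'rV[R]_d) :
  dot x (a *: y) = a * dot x y.
Proof. by rewrite dotC dotZl dotC. Qed.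

Lemma dotNr {R : realType} {d : nat} (x y : 'rV[R]_d) : dot x (- y) = - dot x y.
Proof. by rewrite dotC dotNl dotC. Qed.

Definition dot_linE := (@dotDl, @dotDr, @dotNl, @dotNr, @dotZl, @dotZr).

Lemma dot_ge0 {R : realType} {d : nat} (x : 'rV[R]_d) : 0 <= dot x x.
Proof. by apply: sumr_ge0 => i _; rewrite -expr2 sqr_ge0. Qed.

Lemma dot0 {R : realType} {d : nat} (x : 'rV[R]_d) : dot 0 x = 0.
Proof. by rewrite -(scale0r x) dotZl mul0r. Qed.

Lemma dot_gt0 {R : realType} {d : nat} (x : 'rV[R]_d) : x != 0 -> 0 < dot x x.
Proof.
move=> x0; rewrite lt_neqAle dot_ge0 andbT eq_sym.
by apply: contraNneq x0 => /dot_eq0 ->.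
Qed.

Lemma dot_cauchy_schwarz {R : realType} {d : nat} (x y : 'rV[R]_d) :
  dot x y ^+ 2 <= dot x x * dot y y.
Proof.
have [->|/dot_gt0 y0] := eqVneq y 0; first by rewrite dotC !dot0; lra.
have := dot_ge0 (dot y y *: x - dot x y *: y).
rewrite !dot_linE (dotC y x) => h.
rewrite -subr_ge0 -(pmulr_rge0 _ y0); apply: le_trans h _; lra.
Qed.

Lemma enorm_ge0 {R : realType} {d : nat} (x : 'rV[R]_d) : 0 <= enorm x.
Proof. exact: sqrtr_ge0. Qed.

Lemma enorm_sqr {R : realType} {d : nat} (x : 'rV[R]_d) :
  enorm x ^+ 2 = dot x x.
Proof. by rewrite sqr_sqrtr ?dot_ge0. Qed.

Lemma enorm_gt0 {R : realType} {d : nat} (x : 'rV[R]_d) :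
  (0 < enorm x) = (0 < dot x x).
Proof. exact: sqrtr_gt0. Qed.

Lemma enormN {R : realType} {d : nat} (x : 'rV[R]_d) : enorm (- x) = enorm x.
Proof. by rewrite /enorm !dot_linE opprK. Qed.

Lemma enormZ {R : realType} {d : nat} a (x : 'rV[R]_d) :
  enorm (a *: x) = `|a| * enorm x.
Proof. by rewrite /enorm !dot_linE mulrA -expr2 sqrtrM ?sqr_ge0 // sqrtr_sqr. Qed.

Lemma normr_dot_le {R : realType} {d : nat} (x y : 'rV[R]_d) :
  `|dot x y| <= enorm x * enorm y.
Proof.
rewrite -ler_sqr ?nnegrE ?mulr_ge0 ?enorm_ge0 ?normr_ge0 //.
by rewrite real_normK ?num_real // exprMn !enorm_sqr dot_cauchy_schwarz.
Qed.

Lemma enormD {R : realType} {d : nat} (x y : 'rV[R]_d) :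
  enorm (x + y) <= enorm x + enorm y.
Proof.
rewrite -ler_sqr ?nnegrE ?addr_ge0 ?enorm_ge0 //.
have := normr_dot_le x y; rewrite ler_norml => /andP[_ h].
rewrite sqrrD !enorm_sqr !dot_linE (dotC y x) mulr2n; lra.
Qed.

(** * Unnormalised interventions and their effect on areas *)

(** The vector that [intervene] normalises. It is linear in [x], so that normalisation can be
    postponed to the end. *)
Definition push {R : realType} {d : nat} (eta : R) (x w : 'rV[R]_d) : 'rV[R]_d :=
  x + (eta * dot x w) *: w.

Lemma pushZ {R : realType} {d : nat} (eta a : R) (x w : 'rV[R]_d) :
  push eta (a *: x) w = a *: push eta x w.
Proof. by rewrite /push dotZl scalerDr scalerA mulrCA. Qed.

Lemma pushN {R : realType} {d : nat} (eta : R) (x w : 'rV[R]_d) :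
  push eta (- x) w = - push eta x w.
Proof. by rewrite -(scaleN1r x) pushZ scaleN1r. Qed.

Lemma foldl_pushN {R : realType} {d : nat} (eta : R) s (x : 'rV[R]_d) :
  foldl (push eta) (- x) s = - foldl (push eta) x s.
Proof. by elim: s x => //= w s IH x; rewrite pushN IH. Qed.

(** The matrix [I + eta w w^T] is symmetric, and its square is [I + (2 eta + eta^2) w w^T] for a
    unit vector [w]. *)
Lemma dot_push {R : realType} {d : nat} (eta : R) (x y w : 'rV[R]_d) :
  enorm w = 1 ->
  dot (push eta x w) (push eta y w) =
  dot x y + (2 * eta + eta ^+ 2) * (dot x w * dot y w).
Proof.
move=> w1; rewrite /push !dot_linE -enorm_sqr w1 (dotC w y); ring.
Qed.

(* [push eta _ w] has the singular values [1 + eta, 1, ..., 1], so it expands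
   areas by at most [1 + eta]. *)
Lemma gram_push {R : realType} {d : nat} (eta : R) (x y w : 'rV[R]_d) :
  0 < eta -> enorm w = 1 ->
  let x' := push eta x w in let y' := push eta y w in
  dot x' x' * dot y' y' - dot x' y' ^+ 2 <=
  (1 + eta) ^+ 2 * (dot x x * dot y y - dot x y ^+ 2).
Proof.
move=> eta0 w1 /=; rewrite !dot_push //.
(* The two sides of the goal differ by [2 * eta + eta ^+ 2] times the Gram determinant of the
   components of [x] and [y] orthogonal to [w], which is nonnegative by Cauchy-Schwarz. *)
have := dot_cauchy_schwarz (x - dot x w *: w) (y - dot y w *: w).
rewrite !dot_linE -(enorm_sqr w) w1 !(dotC w) !expr1n.
set X := dot x x; set Y := dot y y; set Z := dot x y.
set a := dot x w; set b := dot y w => h.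
have k0 : 0 < 2 * eta + eta ^+ 2 by apply: addr_gt0; [lra|rewrite exprn_gt0].
rewrite -subr_ge0.
have -> : (1 + eta) ^+ 2 * (X * Y - Z ^+ 2) -
  ((X + (2 * eta + eta ^+ 2) * (a * a)) * (Y + (2 * eta + eta ^+ 2) * (b * b)) -
  (Z + (2 * eta + eta ^+ 2) * (a * b)) ^+ 2) =
  (2 * eta + eta ^+ 2) * (X * Y - Z ^+ 2 - a ^+ 2 * Y - b ^+ 2 * X + 2 * a * b * Z).
  by ring.
by rewrite pmulr_rge0 //; nra.
Qed.

(** Folding over the word of interventions lets [foldl_cat] split off a final block of repeated
    ones. *)
Definition flow {R : realType} {d : nat} (eta : R) (x : 'rV[R]_d)
    (vs : nat -> 'rV[R]_d) (t : nat) : 'rV[R]_d :=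
  foldl (push eta) x (mkseq vs t).

Lemma flowS {R : realType} {d : nat} (eta : R) (x : 'rV[R]_d) vs t :
  flow eta x vs t.+1 = push eta (flow eta x vs t) (vs t).
Proof. by rewrite /flow mkseqS foldl_rcons. Qed.

Lemma flowN {R : realType} {d : nat} (eta : R) (x : 'rV[R]_d) vs t :
  flow eta (- x) vs t = - flow eta x vs t.
Proof. exact: foldl_pushN. Qed.

(** Pushes commute with scaling, so normalising at every step or once at the end gives the same
    vector; pushes do not decrease the norm, which therefore stays positive. *)
Lemma opinionE {R : realType} {d : nat} (eta : R) (u : 'rV[R]_d) vs t :
  0 < eta -> (forall i, enorm (vs i) = 1) -> enorm u = 1 ->
  opinion eta u vs t =
  (enorm (flow eta u vs t))^-1 *: flow eta u vs t
  /\ 0 < enorm (flow eta u vs t).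
Proof.
move=> eta0 vs1 u1; elim: t => [|t [IHu IH]].
  by rewrite /= u1 invr1 scale1r ltr01.
rewrite flowS [opinion _ _ _ _]/= IHu.
set x := flow _ _ _ _ in IH *.
have x'0 : 0 < enorm (push eta x (vs t)).
  move: IH; rewrite !enorm_gt0 dot_push // => x0.
  by apply: ltr_pwDl => //; rewrite mulr_ge0 -?expr2 ?sqr_ge0 // addr_ge0 ?sqr_ge0; lra.
split=> //; rewrite /intervene -/(push eta (_ *: x) (vs t)) pushZ enormZ.
rewrite ger0_norm ?invr_ge0 ?ltW // invfM invrK scalerA mulrAC divff ?mul1r //.
by rewrite gt_eqF.
Qed.

Lemma opinionN {R : realType} {d : nat} (eta : R) (u : 'rV[R]_d) vs t :
  0 < eta -> (forall i, enorm (vs i) = 1) -> enorm u = 1 ->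
  opinion eta (- u) vs t = - opinion eta u vs t.
Proof.
move=> eta0 vs1 u1; have [-> _] := opinionE eta u vs t eta0 vs1 u1.
have [|-> _] := opinionE eta (- u) vs t eta0 vs1; first by rewrite enormN.
by rewrite flowN enormN scalerN.
Qed.

(** * The invariant cone: stability, growth and entry *)

(** The two interventions are indexed by [bool], so that a finite history of them is a
    [seq bool]. *)
Definition cone {R : realType} {d : nat} (c : R) (w : bool -> 'rV[R]_d)
    (x : 'rV[R]_d) : Prop :=
  forall b, c * enorm x <= dot x (w b).

(** On the cone a push adds a nonnegative multiple of [w b], which itself lies in the cone, and the
    cone is convex. *)
Lemma cone_push {R : realType} {d : nat} (eta c : R) (w : bool -> 'rV[R]_d) x b :
  0 < eta -> 0 <= c -> (forall b, enorm (w b) = 1) ->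
  (forall b b', c <= dot (w b) (w b')) ->
  cone c w x -> cone c w (push eta x (w b)).
Proof.
move=> eta0 c0 w1 cw xc b'; have a0 : 0 <= eta * dot x (w b).
  apply: mulr_ge0; first exact: ltW.
  by apply: le_trans (xc b); rewrite mulr_ge0 ?enorm_ge0.
apply: (@le_trans _ _ (c * (enorm x + eta * dot x (w b)))).
  apply: ler_wpM2l => //; apply: le_trans (enormD _ _) _.
  by rewrite enormZ w1 mulr1 ger0_norm.
rewrite /push !dot_linE mulrDr lerD // mulrC ler_wpM2l //.
Qed.

Lemma cone_push_growth {R : realType} {d : nat} (eta c : R)
    (w : bool -> 'rV[R]_d) x b :
  0 < eta -> 0 <= c -> (forall b, enorm (w b) = 1) -> cone c w x ->
  (1 + (2 * eta + eta ^+ 2) * c ^+ 2) * dot x x <=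
  dot (push eta x (w b)) (push eta x (w b)).
Proof.
move=> eta0 c0 w1 xc; rewrite dot_push // mulrDl mul1r lerD2l -mulrA.
rewrite ler_wpM2l ?addr_ge0 ?sqr_ge0 //; first lra.
rewrite -enorm_sqr -exprMn -expr2 lerXn2r ?nnegrE ?mulr_ge0 ?enorm_ge0 //.
by rewrite (le_trans _ (xc b)) // mulr_ge0 ?enorm_ge0.
Qed.

(** Each push multiplies the component along [v] by [1 + eta] and fixes the component orthogonal to
    [v]. *)
Lemma foldl_push_nseq {R : realType} {d : nat} (eta : R) (x v : 'rV[R]_d) n :
  enorm v = 1 ->
  foldl (push eta) x (nseq n v) = x + (((1 + eta) ^+ n - 1) * dot x v) *: v.
Proof.
move=> v1; elim: n x => [|n IH] x; first by rewrite expr0 subrr mul0r scale0r addr0.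
rewrite /= IH /push !dot_linE -enorm_sqr v1 -addrA -scalerDl.
by congr (_ + _ *: _); rewrite (exprS (1 + eta)); ring.
Qed.

Lemma bernoulli_inequality {R : realType} (eta : R) n :
  0 <= eta -> 1 + n%:R * eta <= (1 + eta) ^+ n.
Proof.
move=> eta0; elim: n => [|n IH]; first by rewrite mul0r addr0.
have := ler_wpM2l (_ : 0 <= 1 + eta) IH; rewrite -exprS => /(_ _) h.
apply: le_trans (h _); last lra.
have := ler0n R n; rewrite -natr1; nra.
Qed.

(* Under repeated pushes along [w b] a vector turns towards [+- w b], at a rate
   controlled by [enorm x / |dot x (w b)|], and [w b] is interior to the cone. *)
Lemma cone_enter {R : realType} {d : nat} (eta c c1 M : R)
    (w : bool -> 'rV[R]_d) :
  0 < eta -> 0 <= c -> c < c1 -> 0 <= M -> (forall b, enorm (w b) = 1) ->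
  (forall b b', c1 <= dot (w b) (w b')) ->
  exists n, forall b x, enorm x <= M * `|dot x (w b)| ->
  let y := foldl (push eta) x (nseq n (w b)) in cone c w y \/ cone c w (- y).
Proof.
move=> eta0 c0 cc1 M0 w1 cw.
(* With [a = dot z (w b) >= 0], the final vector has norm at most [(M + g) * a] and inner products
   at least [(g * c1 - M) * a]. It is in the cone once [(1 + c) * M <= g * (c1 - c)], and Bernoulli
   gives [g >= n * eta]. *)
pose q := (1 + c) * M / (c1 - c) / eta.
have q0 : 0 <= q by rewrite !divr_ge0 ?mulr_ge0 ?subr_ge0 //; lra.
exists (Num.bound q) => b x xM.
set n := Num.bound q; set g := (1 + eta) ^+ n - 1.
have gq : (1 + c) * M <= g * (c1 - c).
  rewrite -ler_pdivrMr ?subr_gt0 //; have := archi_boundP q0.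
  rewrite -/n /q ltr_pdivrMr // => h; have := bernoulli_inequality eta n (ltW eta0).
  rewrite /g; lra.
have g0 : 0 <= g by rewrite subr_ge0 exprn_ege1 //; lra.
have enter z : enorm z <= M * dot z (w b) -> 0 <= dot z (w b) ->
    cone c w (foldl (push eta) z (nseq n (w b))).
  move=> zM a0 b'; rewrite foldl_push_nseq // -/g.
  set a := dot z (w b) in zM a0 *.
  have ga0 : 0 <= g * a by exact: mulr_ge0.
  apply: (@le_trans _ _ (c * (M * a + g * a))).
    apply: ler_wpM2l => //; apply: le_trans (enormD _ _) _.
    by rewrite enormZ w1 mulr1 (ger0_norm ga0) lerD.
  rewrite dotDl dotZl; have := ler_wpM2l ga0 (cw b b').
  have := normr_dot_le z (w b'); rewrite w1 mulr1 ler_norml => /andP[h _].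
  have := ler_wpM2r a0 gq; lra.
have [a0|a0] := leP 0 (dot x (w b)).
  by left; apply: enter => //; rewrite ger0_norm in xM.
right; rewrite -foldl_pushN; apply: enter; rewrite ?enormN dotNl; last lra.
by rewrite ltr0_norm in xM.
Qed.

(** Supplies the hypothesis of [cone_enter] with one [M] for the whole span. The Gram matrix of
    [w true] and [w false] has least eigenvalue [1 - c], so the squares of the two inner products
    add up to at least [(1 - c) * dot x x], and the larger one is at least half of that. *)
Lemma span_dot_bound {R : realType} {d : nat} (w : bool -> 'rV[R]_d) :
  (forall b, enorm (w b) = 1) -> 0 <= dot (w true) (w false) < 1 ->
  exists2 M, 0 <= M & forall al be,
  let x := al *: w true + be *: w false in
  exists b, enorm x <= M * `|dot x (w b)|.
Proof.
move=> w1; set c := dot _ _ => /andP[c0 c1].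
pose m : R := 2 / (1 - c); exists (1 + m) => [|al be x].
  by rewrite addr_ge0 ?divr_ge0 //; lra.
have m0 : 0 < m by rewrite divr_gt0 //; lra.
have mE : m * (1 - c) = 2 by rewrite divfK //; lra.
pose a := dot x (w true); pose b := dot x (w false).
have aE : a = al + be * c.
  by rewrite /a /x !dot_linE -enorm_sqr w1 (dotC (w false)) expr1n mulr1.
have bE : b = al * c + be.
  by rewrite /b /x !dot_linE -enorm_sqr w1 expr1n mulr1.
have xx : dot x x = al * a + be * b.
  by rewrite /a /b !(dotC x) -!dotZl -dotDl.
have ab : (1 - c) * dot x x <= a ^+ 2 + b ^+ 2.
  by rewrite xx aE bE; have := sqr_ge0 (al + be); have := sqr_ge0 (al - be); nra.
(* The factor [1 + m] replaces the square root of [m], since [m <= (1 + m) ^+ 2]. *)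
have key t : dot x x <= m * t ^+ 2 -> enorm x <= (1 + m) * `|t|.
  move=> h; rewrite -ler_sqr ?nnegrE ?enorm_ge0 //; last first.
    by rewrite mulr_ge0 ?normr_ge0 //; lra.
  rewrite enorm_sqr exprMn real_normK ?num_real //.
  apply: le_trans h _; apply: ler_wpM2r; rewrite ?sqr_ge0 //; nra.
have h : dot x x <= m / 2 * (a ^+ 2 + b ^+ 2).
  by have := ler_wpM2l (_ : 0 <= m / 2) ab; nra.
have [lab|/ltW lab] := leP (b ^+ 2) (a ^+ 2); [exists true|exists false];
  apply: key; rewrite -/a -/b; nra.
Qed.

(** * Convergence once both V-parts have reached the cone *)

(** A component orthogonal to all interventions is carried along unchanged, so only the V-part
    moves. *)
Lemma flow_shift {R : realType} {d : nat} (eta : R) (p q : 'rV[R]_d) vs t :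
  (forall i, dot q (vs i) = 0) -> dot p q = 0 ->
  flow eta (p + q) vs t = flow eta p vs t + q /\ dot (flow eta p vs t) q = 0.
Proof.
move=> qvs pq; elim: t => [//|t [IH1 IH2]]; rewrite !flowS IH1 /push.
by rewrite !dot_linE qvs addr0 addrAC IH2 (dotC (vs t)) qvs mulr0 addr0.
Qed.

Lemma flow_gram {R : realType} {d : nat} (eta : R) (x y : 'rV[R]_d) vs t :
  0 < eta -> (forall i, enorm (vs i) = 1) ->
  let xt := flow eta x vs t in let yt := flow eta y vs t in
  dot xt xt * dot yt yt - dot xt yt ^+ 2 <=
  ((1 + eta) ^+ 2) ^+ t * (dot x x * dot y y - dot x y ^+ 2).
Proof.
move=> eta0 vs1 /=; elim: t => [|t IH]; first by rewrite mul1r.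
rewrite !flowS; apply: le_trans (gram_push _ _ _ _ eta0 (vs1 t)) _.
by rewrite (exprS _ t) -mulrA ler_wpM2l ?sqr_ge0.
Qed.

(** Dividing by [lam ^+ t0] makes the coefficient of [lam ^+ t] independent of [t], as
    [opinion_sub_cvg0] requires. *)
Lemma flow_cone {R : realType} {d : nat} (eta c : R) (w : bool -> 'rV[R]_d)
    (x : 'rV[R]_d) vs t0 t :
  0 < eta -> 0 <= c -> (forall b, enorm (w b) = 1) ->
  (forall b b', c <= dot (w b) (w b')) -> (forall i, exists b, vs i = w b) ->
  cone c w (flow eta x vs t0) -> (t0 <= t)%N ->
  let lam := 1 + (2 * eta + eta ^+ 2) * c ^+ 2 in
  cone c w (flow eta x vs t) /\
  dot (flow eta x vs t0) (flow eta x vs t0) / lam ^+ t0 * lam ^+ t <=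
  dot (flow eta x vs t) (flow eta x vs t).
Proof.
move=> eta0 c0 w1 cw vsw xc0 t0t lam.
have lam0 : 0 < lam.
  by apply: ltr_pwDl => //; rewrite mulr_ge0 ?addr_ge0 ?sqr_ge0 //; lra.
rewrite -(subnKC t0t); elim: (t - t0)%N => [|k [xc IH]].
  by rewrite addn0 divfK // expf_neq0 // gt_eqF.
rewrite addnS flowS; have [b ->] := vsw (t0 + k)%N; split.
  exact: cone_push.
apply: le_trans (cone_push_growth _ _ _ _ _ eta0 c0 w1 xc).
by rewrite (exprS _ (t0 + k)) mulrCA ler_wpM2l // ltW.
Qed.

Lemma flow_norm_ge {R : realType} {d : nat} (eta : R) (x : 'rV[R]_d) vs t :
  0 < eta -> (forall i, enorm (vs i) = 1) ->
  dot x x <= dot (flow eta x vs t) (flow eta x vs t).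
Proof.
move=> eta0 vs1; elim: t => [//|t IH]; apply: le_trans IH _.
rewrite flowS dot_push // lerDl mulr_ge0 -?expr2 ?sqr_ge0 //.
by rewrite addr_ge0 ?sqr_ge0 //; lra.
Qed.

(** If [r] is the cosine of the angle between the two flows, [1 - r ^+ 2] is their Gram determinant
    over the product of their squared norms, hence of order [((1 + eta) / lam) ^+ (2 * t)]. As
    [r >= 0], this also controls the squared distance [2 - 2 * r] of the opinions. *)
Lemma opinion_sub_cvg0 {R : realType} {d : nat} (eta lam k1 k2 : R)
    (u1 u2 : 'rV[R]_d) vs T :
  0 < eta -> (forall i, enorm (vs i) = 1) -> enorm u1 = 1 -> enorm u2 = 1 ->
  1 + eta < lam -> 0 < k1 -> 0 < k2 ->
  (forall t, (T <= t)%N -> k1 * lam ^+ t <= enorm (flow eta u1 vs t) ^+ 2) ->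
  (forall t, (T <= t)%N -> k2 * lam ^+ t <= enorm (flow eta u2 vs t) ^+ 2) ->
  (forall t, (T <= t)%N -> 0 <= dot (flow eta u1 vs t) (flow eta u2 vs t)) ->
  enorm (opinion eta u1 vs t - opinion eta u2 vs t) @[t --> \oo] --> (0 : R).
Proof.
move=> eta0 vs1 u11 u21 lam_gt k10 k20 grow1 grow2 pos.
have lam0 : 0 < lam by apply: lt_trans lam_gt; lra.
(* [D] is chosen so that [D ^+ 2 >= 2 / (k1 * k2)], which avoids a square root. *)
pose q := (1 + eta) / lam; pose D := 1 + 2 / (k1 * k2).
have D1 : 1 <= D by rewrite lerDl divr_ge0 ?mulr_ge0 // ltW.
have q0 : 0 <= q by rewrite divr_ge0 ?ltW //; lra.
have qD0 : geometric D q t @[t --> \oo] --> 0.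
  by apply: cvg_geometric; rewrite ger0_norm // ltr_pdivrMr // mul1r.
apply: (@squeeze_cvgr _ _ _ _ (fun=> 0) (geometric D q)) => //; last exact: cvg_cst.
exists T => // t /= Tt; rewrite enorm_ge0 /=.
have qt0 : 0 <= q ^+ t by exact: exprn_ge0.
rewrite -ler_sqr ?nnegrE ?enorm_ge0 ?mulr_ge0 //; last by lra.
have [-> x0] := opinionE eta u1 vs t eta0 vs1 u11.
have [-> y0] := opinionE eta u2 vs t eta0 vs1 u21.
have := flow_gram eta u1 u2 vs t eta0 vs1; rewrite /= -!enorm_sqr u11 u21.
have := grow1 t Tt; have := grow2 t Tt; have := pos t Tt.
rewrite (enorm_sqr (_ *: _ - _)) !dot_linE.
set x := flow _ _ _ _ in x0 *; set y := flow _ _ _ _ in y0 *.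
set X := enorm x in x0 *; set Y := enorm y in y0 *.
rewrite (dotC y x); set Z := dot x y => Z0 Yk Xk gram.
rewrite -!enorm_sqr -/X -/Y.
have XY0 : 0 < X * Y by exact: mulr_gt0.
pose r := Z / (X * Y).
have r0 : 0 <= r by rewrite divr_ge0 // ltW.
have -> : X^-1 * (X^-1 * X ^+ 2) - X^-1 * (Y^-1 * Z) +
    (- (Y^-1 * (X^-1 * Z)) - - (Y^-1 * (Y^-1 * Y ^+ 2))) = 2 - 2 * r.
  by rewrite /r; field; rewrite !gt_eqF.
have rE : 1 - r ^+ 2 = (X ^+ 2 * Y ^+ 2 - Z ^+ 2) / (X * Y) ^+ 2.
  by rewrite /r; field; rewrite !gt_eqF.
have r2 : 1 - r ^+ 2 <= (k1 * k2)^-1 * (q ^+ t) ^+ 2.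
  rewrite rE ler_pdivrMr ?exprn_gt0 //.
  have k12 : 0 < k1 * k2 by exact: mulr_gt0.
  have lamt : 0 < lam ^+ t by exact: exprn_gt0.
  have XYk : (k1 * lam ^+ t) * (k2 * lam ^+ t) <= X ^+ 2 * Y ^+ 2.
    by apply: ler_pM => //; rewrite mulr_ge0 // ltW.
  apply: (@le_trans _ _ (((1 + eta) ^+ 2) ^+ t)).
    apply: le_trans gram _; rewrite -[leRHS]mulr1 ler_wpM2l //.
      by rewrite exprn_ge0 ?sqr_ge0.
    by rewrite !expr1n mulr1 gerBl sqr_ge0.
  have -> : ((1 + eta) ^+ 2) ^+ t = (k1 * k2)^-1 * (q ^+ t) ^+ 2 *
      ((k1 * lam ^+ t) * (k2 * lam ^+ t)).
    rewrite exprAC /q expr_div_n; field.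
    by rewrite !gt_eqF.
  by rewrite [(X * Y) ^+ 2]exprMn ler_wpM2l // mulr_ge0 ?sqr_ge0 ?invr_ge0 ?ltW.
have Dk : 2 * (k1 * k2)^-1 <= D ^+ 2.
  have := D1; rewrite /D; set m := 2 / _ => m0; nra.
have qt2 := sqr_ge0 (q ^+ t).
have qD := ler_wpM2r qt2 Dk; rewrite /geometric /= exprMn.
apply: le_trans qD; rewrite -mulrA.
have : 0 <= (k1 * k2)^-1 * (q ^+ t) ^+ 2.
  by rewrite mulr_ge0 // invr_ge0 mulr_ge0 // ltW.
(* For [0 <= r <= 1], [1 - r <= (1 - r) * (1 + r)]; for [r > 1] the left side of the goal is
   negative. *)
by have [r1|r1] := leP r 1; nra.
Qed.

Lemma opinion_cone {R : realType} {d : nat} (eta c : R) (w : bool -> 'rV[R]_d)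
    (p1 p2 q1 q2 : 'rV[R]_d) vs t1 t2 :
  0 < eta -> 0 <= c -> 1 < c ^+ 2 * (2 + eta) ->
  (forall b, enorm (w b) = 1) -> (forall b b', c <= dot (w b) (w b')) ->
  (forall i, exists b, vs i = w b) ->
  enorm (p1 + q1) = 1 -> enorm (p2 + q2) = 1 -> p1 != 0 -> p2 != 0 ->
  (forall b, dot q1 (w b) = 0) -> (forall b, dot q2 (w b) = 0) ->
  dot p1 q1 = 0 -> dot p2 q2 = 0 ->
  cone c w (flow eta p1 vs t1) -> cone c w (flow eta p2 vs t2) ->
  let o1 t := opinion eta (p1 + q1) vs t in
  let o2 t := opinion eta (p2 + q2) vs t in
  (enorm (o1 t - o2 t) @[t --> \oo] --> (0 : R)) \/
  (enorm (o1 t + o2 t) @[t --> \oo] --> (0 : R)).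
Proof.
move=> eta0 c0 c_eta w1 cw vsw u11 u21 p10 p20 q1w q2w p1q p2q cone1 cone2 /=.
have vs1 i : enorm (vs i) = 1 by have [b ->] := vsw i.
pose lam := 1 + (2 * eta + eta ^+ 2) * c ^+ 2.
have lam_gt : 1 + eta < lam.
  rewrite ltrD2l.
  have -> : (2 * eta + eta ^+ 2) * c ^+ 2 = eta * (c ^+ 2 * (2 + eta)) by ring.
  by rewrite ltr_pMr.
have lam0 : 0 < lam by apply: lt_trans lam_gt; lra.
(* The fixed orthogonal part [q] only increases the norm and leaves the inner products with [w b]
   unchanged, so [p + q] inherits both bounds from [p]. *)
have grow p q t0 : p != 0 -> (forall b, dot q (w b) = 0) -> dot p q = 0 ->
    cone c w (flow eta p vs t0) -> exists2 k, 0 < k & forall t, (t0 <= t)%N ->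
    k * lam ^+ t <= enorm (flow eta (p + q) vs t) ^+ 2 /\
    forall b, 0 <= dot (flow eta (p + q) vs t) (w b).
  move=> p0 qw pq conep.
  exists (dot (flow eta p vs t0) (flow eta p vs t0) / lam ^+ t0).
    rewrite divr_gt0 ?exprn_gt0 //; apply: lt_le_trans (flow_norm_ge _ _ _ _ eta0 vs1).
    exact: dot_gt0.
  move=> t t0t; have qvs i : dot q (vs i) = 0 by have [b ->] := vsw i.
  have [-> ptq] := flow_shift eta p q vs t qvs pq.
  have [conet growt] := flow_cone _ _ _ _ _ _ _ eta0 c0 w1 cw vsw conep t0t.
  split=> [|b].
    apply: le_trans growt _; rewrite enorm_sqr !dot_linE ptq (dotC q) ptq.
    by rewrite addr0 add0r lerDl dot_ge0.
  by rewrite dotDl qw addr0 (le_trans _ (conet b)) // mulr_ge0 ?enorm_ge0.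
have [k1 k10 grow1] := grow _ _ _ p10 q1w p1q cone1.
have [k2 k20 grow2] := grow _ _ _ p20 q2w p2q cone2.
pose T := maxn t1 t2; pose z t := dot (flow eta (p1 + q1) vs t) (flow eta (p2 + q2) vs t).
(* By [dot_push], each step adds a nonnegative multiple of a product of two inner products that are
   nonnegative from [T] on. *)
have zS t : (T <= t)%N -> z t <= z t.+1.
  rewrite geq_max => /andP[tt1 tt2]; rewrite /z !flowS dot_push // lerDl.
  have [b ->] := vsw t; rewrite mulr_ge0 ?addr_ge0 ?sqr_ge0 //; first lra.
  by rewrite mulr_ge0 ?(grow1 t tt1).2 ?(grow2 t tt2).2.
(* Either [z] reaches a nonnegative value and stays nonnegative, or it is negative from [T] on and
   the second opinion is replaced by its opposite. *)
have [[T1 TT1 zT1]|zneg] := pselect (exists2 T1, (T <= T1)%N & 0 <= z T1).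
  left; apply: (@opinion_sub_cvg0 _ _ eta lam k1 k2 _ _ _ T1) => //.
  - move=> t T1t; apply: (grow1 t _).1.
    by apply: leq_trans T1t; apply: leq_trans TT1; exact: leq_maxl.
  - move=> t T1t; apply: (grow2 t _).1.
    by apply: leq_trans T1t; apply: leq_trans TT1; exact: leq_maxr.
  - move=> t T1t; rewrite -(subnKC T1t); elim: (t - T1)%N => [|k IH].
      by rewrite addn0.
    rewrite addnS; apply: le_trans IH _; apply: zS.
    exact: leq_trans TT1 (leq_addr _ _).
right; rewrite (_ : (fun t => _) = fun t =>
    enorm (opinion eta (p1 + q1) vs t - opinion eta (- (p2 + q2)) vs t)); last first.
  by apply/funext => t; rewrite opinionN // opprK.
apply: (@opinion_sub_cvg0 _ _ eta lam k1 k2 _ _ _ T) => //.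
- by rewrite enormN.
- by move=> t Tt; apply: (grow1 t _).1; apply: leq_trans Tt; exact: leq_maxl.
- move=> t Tt; rewrite flowN enormN; apply: (grow2 t _).1.
  by apply: leq_trans Tt; exact: leq_maxr.
- move=> t Tt; rewrite flowN dotNr oppr_ge0; apply/ltW.
  by rewrite ltNge; apply/negP => zt; apply: zneg; exists t.
Qed.

(** * Negligibility of events that exclude some continuation of every word *)

(** Measurable covers [F] serve to bound [A], which may be non-measurable. Along [r], each letter
    leaves one other branch to cover, at half the previous cost, and nothing remains at the end of
    [r]: the total factor is [1/2 + 1/4 + ... = 1 - (1/2)^(size r)]. *)
Lemma cover_avoiding_word {dT : measure_display} {Omega : measurableType dT}
    {R : realType} (P : probability Omega R) (C : seq bool -> set Omega)
    (N A : set Omega) (K : R) :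
  (forall s, C s `\` N `<=` C (rcons s true) `|` C (rcons s false)) ->
  (forall s, exists F, [/\ measurable F,
    (P F <= ((1 / 2) ^+ size s * K)%:E)%E & (A `&` C s) `\` N `<=` F]) ->
  forall r s, A `&` C (s ++ r) `<=` set0 -> exists F, [/\ measurable F,
    (P F <= ((1 / 2) ^+ size s * ((1 - (1 / 2) ^+ size r) * K))%:E)%E &
    (A `&` C s) `\` N `<=` F].
Proof.
move=> splitC cover; elim=> [|b r IH] s.
  rewrite cats0 => ACs; exists set0; split=> //.
    by rewrite measure0 expr0 subrr mul0r mulr0.
  by move=> x [/ACs].
(* [F1] covers the branch that follows [r], by induction; [F2] covers the branch of the other
   letter, by [cover]. *)
rewrite -cat_rcons => /IH[F1 [mF1 PF1 sF1]].
have [F2 [mF2 PF2 sF2]] := cover (rcons s (~~ b)).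
exists (F1 `|` F2); split; first exact: measurableU.
- apply: le_trans (measureU2 P mF1 mF2) _; apply: le_trans (leeD PF1 PF2) _.
  by rewrite -EFinD lee_fin !size_rcons /= !exprS; lra.
- move=> x [[Ax Cx] Nx]; have := splitC s x (conj Cx Nx).
  by case: b {PF1 PF2} sF1 sF2 => /= sF1 sF2 [] ?; [left; apply: sF1|right; apply: sF2|
    right; apply: sF2|left; apply: sF1].
Qed.

(* [C s] is the event that the coin tosses start with the word [s]. *)
Lemma negligible_avoiding_words {dT : measure_display}
    {Omega : measurableType dT} {R : realType} (P : probability Omega R)
    (C : seq bool -> set Omega) (N A : set Omega) (n : nat) :
  C [::] = setT -> (forall s, measurable (C s)) ->
  (forall s, P (C s) = ((1 / 2) ^+ size s)%:E) ->
  (forall s, C s `\` N `<=` C (rcons s true) `|` C (rcons s false)) ->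
  P.-negligible N ->
  (forall s, exists2 r, size r = n & A `&` C (s ++ r) `<=` set0) ->
  P.-negligible A.
Proof.
move=> C0 mC PC splitC Nneg avoid.
pose q : R := 1 - (1 / 2) ^+ n.
(* Each further block of [n] letters gains a factor [q], whatever the past word. *)
have cover J s : exists F, [/\ measurable F,
    (P F <= ((1 / 2) ^+ size s * q ^+ J)%:E)%E & (A `&` C s) `\` N `<=` F].
  elim: J s => [|J IH] s.
    by exists (C s); split=> //; [rewrite mulr1 PC|move=> x [[]]].
  have [r rn ACr] := avoid s.
  by have := cover_avoiding_word P C N A _ splitC IH _ _ ACr; rewrite exprS /q rn.
(* The intersection of the covers at the empty word has measure at most [q ^+ J] for all [J], hence
   zero. *)
have [F HF] := choice (fun J => cover J [::]).
have mF : measurable (\bigcap_J F J).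
  by apply: bigcap_measurable => // J _; have [] := HF J.
have half_n : 0 < (1 / 2 : R) ^+ n <= 1.
  by rewrite exprn_gt0 ?exprn_ile1 //; lra.
have PF0 : P (\bigcap_J F J) = 0%E.
  apply/eqP; rewrite -measure_le0.
  have /cvg_expr qJ : `|q| < 1 by rewrite ger0_norm /q; lra.
  rewrite -(fineK (fin_num_measure P _ mF)) lee_fin.
  apply: (cvgr_to_ge qJ); apply: nearW => J /=.
  have [mFJ PFJ _] := HF J; rewrite [size _]/= expr0 mul1r in PFJ.
  rewrite -lee_fin fineK ?fin_num_measure //; apply: (le_trans _ PFJ).
  by rewrite le_measure ?inE //; exact: bigcap_inf.
apply: (@negligibleS _ _ _ _ (N `|` \bigcap_J F J)); last first.
  by apply: negligibleU => //; exists (\bigcap_J F J); split.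
move=> x Ax; have [|Nx] := pselect (N x); first by left.
by right => J _; have [_ _] := HF J; apply; rewrite C0.
Qed.

(** * Words of coin tosses and their probabilities *)

Definition tosses {dT : measure_display} {Omega : measurableType dT}
    {R : realType} {d : nat} {P : probability Omega R}
    (X : nat -> {RV P >-> borel_rV R d}) (w : bool -> 'rV[R]_d) (s : seq bool) :
    set Omega :=
  [set o | mkseq (X ^~ o) (size s) = [seq w b | b <- s]].

Lemma measurable_preimage1 {dT : measure_display} {Omega : measurableType dT}
    {R : realType} {d : nat} {P : probability Omega R}
    (X : {RV P >-> borel_rV R d}) (x : 'rV[R]_d) :
  measurable ([set x] : set (borel_rV R d)) /\ measurable [set o | X o = x].
Proof.
have m1 : measurable ([set x] : set (borel_rV R d)).
  rewrite -(setCK [set x]); apply: measurableC; apply: sub_sigma_algebra.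
  apply: closed_openC; apply: accessible_closed_set1.
  exact/hausdorff_accessible/norm_hausdorff.
split=> //; rewrite -[X in measurable X](setTI (X @^-1` [set x])).
exact: measurable_funP.
Qed.

Lemma tosses_measure {dT : measure_display} {Omega : measurableType dT}
    {R : realType} {d : nat} (P : probability Omega R)
    (X : nat -> {RV P >-> borel_rV R d}) (w : bool -> 'rV[R]_d) (s : seq bool) :
  mutually_independent X ->
  (forall t b, P [set o | X t o = w b] = (1 / 2)%:E) ->
  measurable (tosses X w s) /\ P (tosses X w s) = ((1 / 2) ^+ size s)%:E.
Proof.
(* Independence is applied to the indices in [J], all below [size s], where the default [true] is
   not read. *)
move=> indX PX; pose B i : set (borel_rV R d) := [set w (nth true s i)].
pose J := [fset i in iota 0 (size s)]%fset.
have tossesE : tosses X w s = \bigcap_(i in [set` J]) (X i @^-1` B i).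
  apply/seteqP; split=> o /=.
    move=> Xs i /=; rewrite !inE mem_iota add0n => ilt.
    by rewrite -(nth_mkseq 0 (X ^~ o) ilt) Xs (nth_map true).
  move=> Xs; apply: (@eq_from_nth _ 0) => [|i]; rewrite size_mkseq ?size_map //.
  move=> ilt; rewrite nth_mkseq // (nth_map true) //.
  by apply: Xs => /=; rewrite !inE mem_iota add0n.
have mX i : measurable (X i @^-1` B i).
  exact: (measurable_preimage1 (X i) _).2.
split.
  by rewrite tossesE; apply: bigcap_measurableType => i _; exact: mX.
rewrite tossesE indX; last by move=> i _; exact: (measurable_preimage1 (X i) _).1.
rewrite (eq_bigr (fun=> (1 / 2)%:E)) => [|i _]; last exact: PX.
rewrite big_const_seq count_predT card_fseq undup_id ?iota_uniq // size_iota.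
by elim: (size s) => //= k ->; rewrite exprS EFinM.
Qed.

(** * Entry into the cone up to sign, and the conclusion *)

(** Replacing one opinion by its opposite negates its whole trajectory and exchanges the two
    alternatives, which reduces the claim to [opinion_cone]. *)
Lemma opinion_cone_pm {R : realType} {d : nat} (eta c : R)
    (w : bool -> 'rV[R]_d) (p1 p2 q1 q2 : 'rV[R]_d) vs t1 t2 :
  0 < eta -> 0 <= c -> 1 < c ^+ 2 * (2 + eta) ->
  (forall b, enorm (w b) = 1) -> (forall b b', c <= dot (w b) (w b')) ->
  (forall i, exists b, vs i = w b) ->
  enorm (p1 + q1) = 1 -> enorm (p2 + q2) = 1 -> p1 != 0 -> p2 != 0 ->
  (forall b, dot q1 (w b) = 0) -> (forall b, dot q2 (w b) = 0) ->
  dot p1 q1 = 0 -> dot p2 q2 = 0 ->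
  cone c w (flow eta p1 vs t1) \/ cone c w (- flow eta p1 vs t1) ->
  cone c w (flow eta p2 vs t2) \/ cone c w (- flow eta p2 vs t2) ->
  let o1 t := opinion eta (p1 + q1) vs t in
  let o2 t := opinion eta (p2 + q2) vs t in
  (enorm (o1 t - o2 t) @[t --> \oo] --> (0 : R)) \/
  (enorm (o1 t + o2 t) @[t --> \oo] --> (0 : R)).
Proof.
move=> eta0 c0 c_eta w1 cw vsw u11 u21 p10 p20 q1w q2w p1q p2q.
have vs1 i : enorm (vs i) = 1 by have [b ->] := vsw i.
have Nw q : (forall b, dot q (w b) = 0) -> forall b, dot (- q) (w b) = 0.
  by move=> qw b; rewrite dotNl qw oppr0.
have swap (a b : nat -> 'rV[R]_d) :
    (enorm (- a t - b t) @[t --> \oo] --> (0 : R)) \/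
    (enorm (- a t + b t) @[t --> \oo] --> (0 : R)) ->
    (enorm (a t - b t) @[t --> \oo] --> (0 : R)) \/
    (enorm (a t + b t) @[t --> \oo] --> (0 : R)).
  rewrite (_ : (fun t => enorm (- a t - b t)) = fun t => enorm (a t + b t)).
    rewrite (_ : (fun t => enorm (- a t + b t)) = fun t => enorm (a t - b t)).
      by case; [right|left].
    by apply/funext => t; rewrite -enormN opprD opprK.
  by apply/funext => t; rewrite -enormN opprB opprK addrC.
wlog: p1 q1 u11 p10 q1w p1q / cone c w (flow eta p1 vs t1).
  move=> base [cone1|]; first by apply: base => //; left.
  rewrite -flowN => cone1 cone2; apply: swap.
  have := base (- p1) (- q1); rewrite -opprD enormN oppr_eq0 dotNl dotNr p1q.
  rewrite !oppr0 => /(_ u11 p10 (Nw _ q1w) erefl cone1 (or_introl cone1) cone2).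
  rewrite /= (_ : (fun t => enorm (opinion eta (- _) vs t - _)) = fun t =>
      enorm (- opinion eta (p1 + q1) vs t - opinion eta (p2 + q2) vs t)); last first.
    by apply/funext => t; rewrite opinionN.
  rewrite (_ : (fun t => enorm (opinion eta (- _) vs t + opinion _ _ _ _)) = fun t =>
      enorm (- opinion eta (p1 + q1) vs t + opinion eta (p2 + q2) vs t)) //.
  by apply/funext => t; rewrite opinionN.
move=> cone1 _ [cone2|]; first by apply: (@opinion_cone _ _ eta c w _ _ _ _ _ t1 t2).
rewrite -flowN => cone2 /=.
have := @opinion_cone _ _ eta c w p1 (- p2) q1 (- q2) vs t1 t2 eta0 c0 c_eta w1 cw vsw.
rewrite -opprD enormN oppr_eq0 dotNl dotNr p2q !oppr0.
move=> /(_ u11 u21 p10 p20 q1w (Nw _ q2w) p1q erefl cone1 cone2) /=.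
rewrite (_ : (fun t => enorm (_ - opinion eta (- _) vs t)) = fun t =>
    enorm (opinion eta (p1 + q1) vs t + opinion eta (p2 + q2) vs t)); last first.
  by apply/funext => t; rewrite opinionN // opprK.
rewrite (_ : (fun t => enorm (opinion _ _ _ _ + opinion eta (- _) vs t)) = fun t =>
    enorm (opinion eta (p1 + q1) vs t - opinion eta (p2 + q2) vs t)).
  by case; [right|left].
by apply/funext => t; rewrite opinionN.
Qed.

Lemma foldl_push_span {R : realType} {d : nat} (eta : R) (w : bool -> 'rV[R]_d)
    s al be :
  exists al' be', foldl (push eta) (al *: w true + be *: w false)
    [seq w b | b <- s] = al' *: w true + be' *: w false.
Proof.
elim: s al be => [|b s IH] al be; first by exists al, be.
rewrite /= /push; case: b; first by rewrite addrAC -scalerDl; exact: IH.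
by rewrite -addrA -scalerDl; exact: IH.
Qed.

Lemma orth_proj_pairP {R : realType} {d : nat} (v v' u : 'rV[R]_d) :
  let p := orth_proj (v + v')%MS u in
  (exists al be, p = al *: v + be *: v') /\
  [/\ dot (u - p) v = 0, dot (u - p) v' = 0 & dot p (u - p) = 0].
Proof.
have [pV orth] := orth_projP (v + v')%MS u; split.
  have /sub_addsmxP[[a b] /= ->] := pV.
  exists (a 0 0), (b 0 0).
  by rewrite {1}(mx11_scalar a) {1}(mx11_scalar b) !mul_scalar_mx.
by split; [exact/orth/addsmxSl|exact/orth/addsmxSr|rewrite dotC; exact: orth].
Qed.

Lemma negligible_never_cone {R : realType} {d : nat} (eta c c1 : R)
    (w : bool -> 'rV[R]_d) (al be : R) {dT : measure_display}
    {Omega : measurableType dT} (P : probability Omega R)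
    (X : nat -> {RV P >-> borel_rV R d}) :
  0 < eta -> 0 <= c -> c < c1 -> (forall b, enorm (w b) = 1) ->
  (forall b b', c1 <= dot (w b) (w b')) -> dot (w true) (w false) < 1 ->
  mutually_independent X ->
  (forall t b, P [set o | X t o = w b] = (1 / 2)%:E) ->
  P.-negligible (~` [set o | forall t, exists b, X t o = w b]) ->
  let p t o := flow eta (al *: w true + be *: w false) (X ^~ o) t in
  P.-negligible [set o | ~ exists t, cone c w (p t o) \/ cone c w (- p t o)].
Proof.
move=> eta0 c0 cc1 w1 cw wlt indX PX Nneg p.
have [|M M0 bound] := span_dot_bound w w1.
  by rewrite wlt andbT; apply: le_trans (cw _ _); apply: le_trans (ltW cc1).
have [n enter] := cone_enter eta c c1 M w eta0 c0 cc1 M0 w1 cw.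
apply: (@negligible_avoiding_words _ _ _ P (tosses X w) _ _ n _ _ _ _ Nneg).
- by apply/seteqP; split.
- by move=> s; have [] := tosses_measure P X w s indX PX.
- by move=> s; have [] := tosses_measure P X w s indX PX.
- move=> s o [Cs]; rewrite /setC /= => /contrapT Xw.
  have [b Xb] := Xw (size s); case: b Xb => Xb; [left|right];
    by rewrite /tosses /= size_rcons mkseqS map_rcons Cs Xb.
(* After the word [s] the vector is still in the span. The favourable letter [b] depends on [s], but
   the number [n] of its repetitions does not. *)
- move=> s; have [al' [be' yE]] := foldl_push_span eta w s al be.
  have [b /enter yb] := bound al' be'; exists (nseq n b); first exact: size_nseq.
  move=> o [never Co]; apply: never; exists (size (s ++ nseq n b)).
  by rewrite /p /flow Co map_cat foldl_cat yE map_nseq.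
Qed.

(** At each time the two values are taken on disjoint events of probability one half, and there are
    countably many times. *)
Lemma tosses_negligible {R : realType} {d : nat} (w : bool -> 'rV[R]_d)
    {dT : measure_display} {Omega : measurableType dT} (P : probability Omega R)
    (X : nat -> {RV P >-> borel_rV R d}) :
  w true != w false ->
  (forall t b, P [set o | X t o = w b] = (1 / 2)%:E) ->
  P.-negligible (~` [set o | forall t, exists b, X t o = w b]).
Proof.
move=> wtf PX.
have mX t b : measurable [set o | X t o = w b].
  exact: (measurable_preimage1 (X t) (w b)).2.
apply: (@negligibleS _ _ _ _ (\bigcup_t ~` [set o | exists b, X t o = w b])).
  by move=> o /= /existsNP[t Xt]; exists t.
apply: negligible_bigcup => t.
have -> : [set o | exists b, X t o = w b] =
    [set o | X t o = w true] `|` [set o | X t o = w false].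
  by apply/seteqP; split=> o /= => [[[] ?]|[] ?]; [left|right|exists true|exists false].
have mU : measurable ([set o | X t o = w true] `|` [set o | X t o = w false]).
  exact: measurableU.
apply/negligibleP; first exact: measurableC.
have tf0 : [set o | X t o = w true] `&` [set o | X t o = w false] = set0.
  by apply/seteqP; split=> o //= [-> ] /eqP; rewrite (negbTE wtf).
have PU : P ([set o | X t o = w true] `|` [set o | X t o = w false]) = 1%E.
  apply: etrans (measureU P (mX t true) (mX t false) tf0) _.
  apply: etrans (congr2 adde (PX t true) (PX t false)) _.
  exact: (congr1 (@EFin R) (esym (splitr (1 : R)))).
by apply: etrans (probability_setC P mU) _; rewrite PU subee.
Qed.

Theorem theorem6p2 (R : realType) (d : nat) (eta : R) (v v' : 'rV[R]_d)
    (u1 u2 : 'rV[R]_d)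
    (dT : measure_display) (Omega : measurableType dT)
    (P : probability Omega R) (X : nat -> {RV P >-> borel_rV R d}) :
  0 < eta ->
  sphere v -> sphere v' -> v != v' ->
  1 / Num.sqrt (2 + eta) < dot v v' ->
  sphere u1 -> sphere u2 ->
  orth_proj (v + v')%MS u1 != 0 -> orth_proj (v + v')%MS u2 != 0 ->
  mutually_independent X ->
  (forall t : nat, P [set omega | X t omega = v] = (1 / 2)%:E /\
                   P [set omega | X t omega = v'] = (1 / 2)%:E) ->
  {ae P, forall omega,
    let u1t := opinion eta u1 (fun t => X t omega) in
    let u2t := opinion eta u2 (fun t => X t omega) in
    (enorm (u1t t - u2t t) @[t --> \oo] --> (0 : R)) \/
    (enorm (u1t t + u2t t) @[t --> \oo] --> (0 : R))}.
Proof.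
move=> eta0 v1 v'1 vv' c1_gt u11 u21.
set p1 := orth_proj _ u1; set p2 := orth_proj _ u2 => p10 p20 indX PX.
pose w (b : bool) := if b then v else v'.
have w1 b : enorm (w b) = 1 by case: b.
have PXw t b : P [set o | X t o = w b] = (1 / 2)%:E.
  by case: b; have [] := PX t.
(* [c] is the midpoint of the threshold [s] and [dot v v']: [s < c] makes the growth factor exceed
   [1 + eta], and [c < dot v v'] puts both interventions in the interior of the cone. *)
pose s := 1 / Num.sqrt (2 + eta); pose c := (s + dot v v') / 2.
have sq : s ^+ 2 * (2 + eta) = 1.
  rewrite /s expr_div_n sqr_sqrtr; last lra.
  by rewrite expr1n divfK // gt_eqF //; lra.
have s0 : 0 < s by rewrite divr_gt0 ?sqrtr_gt0 //; lra.
rewrite -/s in c1_gt.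
have sc : s < c by rewrite /c; lra.
have cc1 : c < dot v v' by rewrite /c; lra.
have c_eta : 1 < c ^+ 2 * (2 + eta).
  by rewrite -[ltLHS]sq ltr_pM2r ?ltrXn2r ?nnegrE //; lra.
have vv'1 : dot v v' < 1.
  have := dot_gt0 (v - v'); rewrite subr_eq0 => /(_ vv').
  by rewrite !dot_linE -!enorm_sqr v1 v'1 (dotC v' v) !expr1n; lra.
have cw b b' : dot v v' <= dot (w b) (w b').
  by case: b b' => -[] /=; rewrite ?(dotC v' v) // -enorm_sqr ?v1 ?v'1 expr1n ltW.
have cw' b b' : c <= dot (w b) (w b') by exact: le_trans (ltW cc1) (cw _ _).
have c0 : 0 <= c by lra.
have Xneg := tosses_negligible w P X vv' PXw.
have never al be := negligible_never_cone eta c _ w al be P X eta0 c0 cc1 w1 cw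
  vv'1 indX PXw Xneg.
have [[al1 [be1 p1E]] [q1v q1v' pq1]] := orth_proj_pairP v v' u1.
have [[al2 [be2 p2E]] [q2v q2v' pq2]] := orth_proj_pairP v v' u2.
(* The exceptional set: some toss is neither [v] nor [v'], or one of the two V-parts never enters
   the cone or its opposite. *)
have := negligibleU Xneg (negligibleU (never al1 be1) (never al2 be2)).
apply: negligibleS => o /= nocvg.
have [Xw|] := pselect (forall t, exists b, X t o = w b); last by left.
have [[t1 cone1]|] := pselect (exists t,
  cone c w (flow eta (al1 *: v + be1 *: v') (X ^~ o) t) \/
  cone c w (- flow eta (al1 *: v + be1 *: v') (X ^~ o) t)); last by right; left.
have [[t2 cone2]|] := pselect (exists t,
  cone c w (flow eta (al2 *: v + be2 *: v') (X ^~ o) t) \/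
  cone c w (- flow eta (al2 *: v + be2 *: v') (X ^~ o) t)); last by right; right.
exfalso; apply: nocvg; rewrite -p1E in cone1; rewrite -p2E in cone2.
have -> : u1 = p1 + (u1 - p1) by rewrite addrC subrK.
have -> : u2 = p2 + (u2 - p2) by rewrite addrC subrK.
apply: (@opinion_cone_pm _ _ eta c w _ _ _ _ _ t1 t2) => //.
- by rewrite addrC subrK.
- by rewrite addrC subrK.
- by case.
- by case.
Qed.
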